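(* Let $\mathcal{X}=(\mathcal{V},\varrho,\upsilon)$ be a fuzzy graph. Then for every vertex $u\in\mathcal{V}$, $$ir_s(\mathcal{X})\le\gamma_s(\mathcal{X})\le {}_{sd}d(u)\le\Gamma_s(\mathcal{X})\le IR_s(\mathcal{X}).$$
   Context: A fuzzy graph $\mathcal{X}=(\mathcal{V},\varrho,\upsilon)$ consists of a nonempty finite set $\mathcal{V}$ of vertices, a function $\varrho:\mathcal{V}\to[0,1]$ and a symmetric function $\upsilon:\mathcal{V}\times\mathcal{V}\to[0,1]$ with $\upsilon(ab)\le\min(\varrho(a),\varrho(b))$ for all $a,b$, and no loops ($\upsilon(aa)=0$). Put $\varrho^*=\{a:\varrho(a)>0\}$ and $\upsilon^*=\{ab:\upsilon(ab)>0\}$; it is assumed that $\mathcal{V}=\varrho^*$, and the elements of $\upsilon^*$ are called edges. A path is a sequence of distinct vertices $a_1,\dots,a_n$ with $\upsilon(a_ia_{i+1})>0$ for all $i<n$; its strength is the minimum of the weights $\upsilon$ of its edges. The strength of connectedness between $a$ and $b$ is the maximum of the strengths of all paths from $a$ to $b$ (and $0$ if there is none). An edge $ab$ is strong if $\upsilon(ab)$ is at least the strength of connectedness between $a$ and $b$ in the fuzzy graph obtained by deleting the edge $ab$. Write $N_s[a]=\{a\}\cup\{b: ab\text{ is a strong edge}\}$. A set $\mathcal{D}\subseteq\mathcal{V}$ is a strong dominating set (SDS) if every $b\in\mathcal{V}\setminus\mathcal{D}$ is joined by a strong edge to some $a\in\mathcal{D}$. An SDS $\mathcal{D}$ is a minimal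 strong dominating set (MSDS) if $\mathcal{D}\setminus\{a\}$ is not an SDS for every $a\in\mathcal{D}$. For $a\in\mathcal{S}\subseteq\mathcal{V}$ the private neighborhood is $P_{N_s}[a,\mathcal{S}]=N_s[a]\setminus\bigcup_{b\in\mathcal{S}\setminus\{a\}}N_s[b]$. A set $\mathcal{S}$ is irredundant if $P_{N_s}[a,\mathcal{S}]\ne\emptyset$ for all $a\in\mathcal{S}$, and maximal irredundant if in addition $\mathcal{S}\cup\{a\}$ is not irredundant for every $a\in\mathcal{V}\setminus\mathcal{S}$. The weight of $\mathcal{S}\subseteq\mathcal{V}$ is $W(\mathcal{S})=\sum_{a\in\mathcal{S}}\min\{\upsilon(ab): ab \text{ is a strong edge}\}$; whenever weights are used it is understood that every vertex is incident with at least one strong edge. Then: $ir_s$ is the minimum weight of a maximal irredundant set; $IR_s$ is the maximum weight of an irredundant set; $\gamma_s$ is the minimum weight of an SDS; $\Gamma_s$ is the maximum weight of an MSDS; the strong domination degree ${}_{sd}d(u)$ of a vertex $u$ is the minimum of the weights of the MSDSs containing $u$. *)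

(* Defs.v *)
From HB Require Import structures.
From mathcomp Require Import all_boot all_order all_algebra.
From mathcomp Require Import reals constructive_ereal.
Set Implicit Arguments.
Unset Strict Implicit.
Unset Printing Implicit Defensive.
Import Order.TTheory GRing.Theory Num.Theory.
Local Open Scope ring_scope.

(* The lower bound on [rho] is strict because every vertex is assumed to lie
   in the support of [rho]. *)
Record fuzzy_graph (R : realType) (V : finType) := FuzzyGraph {
  rho : V -> R;
  ups : V -> V -> R;
  vertices_gt0 : (0 < #|V|)%N;
  rho_itv : forall a, 0 < rho a <= 1;
  ups_itv : forall a b, 0 <= ups a b <= 1;
  ups_sym : forall a b, ups a b = ups b a;
  ups_le_min : forall a b, ups a b <= Num.min (rho a) (rho b);
  ups_loopless : forall a, ups a a = 0
}.

Section FuzzyGraphTheory.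
Variables (R : realType) (V : finType).
Implicit Types (X : fuzzy_graph R V) (a b u : V) (D S : {set V}).

Definition edge X : rel V := fun a b => 0 < ups X a b.

(* [a :: p] is a path from [a] to [b]. *)
Definition is_path X a b (p : seq V) : bool :=
  [&& path (edge X) a p, last a p == b & uniq (a :: p)].

(* Since all edge weights are at most 1, the unit 1 does not affect the
   minimum over a nonempty list of edges. *)
Definition path_strength X a (p : seq V) : R :=
  \big[Num.min/1]_(w <- pairmap (ups X) a p) w.

(* A path visits each vertex at most once, so bounding its length by [#|V|]
   loses no path. *)
Definition conn_strength X a b : R :=
  \big[Num.max/0]_(p : {bseq #|V| of V} | is_path X a b p)
    path_strength X a p.

Definition deleted_ups X a b (x y : V) : R :=
  if ((x == a) && (y == b)) || ((x == b) && (y == a)) then 0 else ups X x y.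

Lemma deleted_ups_itv X a b x y : 0 <= deleted_ups X a b x y <= 1.
Proof.
by rewrite /deleted_ups; case: ifP => _; [rewrite lexx ler01 | exact: ups_itv].
Qed.

Lemma deleted_ups_sym X a b x y :
  deleted_ups X a b x y = deleted_ups X a b y x.
Proof.
rewrite /deleted_ups (ups_sym X x y) orbC.
by rewrite (andbC (y == b)) (andbC (y == a)).
Qed.

Lemma deleted_ups_le_min X a b x y :
  deleted_ups X a b x y <= Num.min (rho X x) (rho X y).
Proof.
apply: le_trans (ups_le_min X x y); rewrite /deleted_ups.
by case: ifP => // _; case/andP: (ups_itv X x y).
Qed.

Lemma deleted_ups_loopless X a b x : deleted_ups X a b x x = 0.
Proof. by rewrite /deleted_ups; case: ifP => // _; exact: ups_loopless. Qed.

Definition delete_edge X a b : fuzzy_graph R V :=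
  FuzzyGraph (vertices_gt0 X) (rho_itv X) (deleted_ups_itv X a b)
    (deleted_ups_sym X a b) (deleted_ups_le_min X a b)
    (deleted_ups_loopless X a b).

Definition strong_edge X a b : bool :=
  edge X a b && (conn_strength (delete_edge X a b) a b <= ups X a b).

Definition strong_nbhd X a : {set V} :=
  [set b | (b == a) || strong_edge X a b].

Definition is_sds X D : bool :=
  [forall b, (b \notin D) ==> [exists a in D, strong_edge X a b]].

Definition is_msds X D : bool :=
  is_sds X D && [forall a in D, ~~ is_sds X (D :\ a)].

Definition private_nbhd X a S : {set V} :=
  strong_nbhd X a :\: \bigcup_(b in S :\ a) strong_nbhd X b.

Definition irredundant X S : bool :=
  [forall a in S, private_nbhd X a S != set0].

Definition maximal_irredundant X S : bool :=
  irredundant X S && [forall a, (a \notin S) ==> ~~ irredundant X (a |: S)].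

(* As for [path_strength], the unit 1 is harmless as soon as [a] is incident
   with a strong edge. *)
Definition vertex_weight X a : R :=
  \big[Num.min/1]_(b | strong_edge X a b) ups X a b.

Definition weight X S : R := \sum_(a in S) vertex_weight X a.

(* Minimum and maximum weight over a finite family of vertex sets. They are
   extended reals so that an empty family gets no artificial finite value:
   its minimum is +oo and its maximum is -oo. *)
Definition min_weight X (P : pred {set V}) : \bar R :=
  \big[mine/+oo%E]_(S : {set V} | P S) (weight X S)%:E.

Definition max_weight X (P : pred {set V}) : \bar R :=
  \big[maxe/-oo%E]_(S : {set V} | P S) (weight X S)%:E.

Definition ir_s X : \bar R := min_weight X (maximal_irredundant X).

Definition IR_s X : \bar R := max_weight X (irredundant X).

Definition gamma_s X : \bar R := min_weight X (is_sds X).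

Definition Gamma_s X : \bar R := max_weight X (is_msds X).

Definition sd_degree X u : \bar R :=
  min_weight X (fun D => is_msds X D && (u \in D)).

End FuzzyGraphTheory.

(* Main.v *)
Require Import Defs.
From mathcomp Require Import all_boot all_order all_algebra.
From mathcomp Require Import reals constructive_ereal.

(** Every minimal strong dominating set is maximal irredundant, and weights are
    monotone under inclusion; this gives the outer inequalities, and for the
    first one a lightest strong dominating set may be shrunk to a minimal one.
    The strong domination degree of [u] is a minimum over a nonempty family:
    a maximal strongly independent set containing [u] is a minimal strong
    dominating set, because strong adjacency is symmetric. *)

Set Implicit Arguments.
Unset Strict Implicit.
Unset Printing Implicit Defensive.
Import Order.TTheory GRing.Theory Num.Theory.
Local Open Scope ring_scope.

Section StrongDomination.
Variables (R : realType) (V : finType).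
Implicit Types (X Y : fuzzy_graph R V) (a b u : V) (p : seq V).
Implicit Types (D S T : {set V}) (P Q : pred {set V}).

(** The tail of the reversed path is [rev (belast a p)]. Its edges are those of the original
    traversed backwards, so symmetry of [ups] preserves the minimum. *)
Lemma path_strength_rev X a p :
  path_strength X (last a p) (rev (belast a p)) = path_strength X a p.
Proof.
rewrite /path_strength; elim: p a => [|c p IHp] a //=.
(* Bring the last edge of the reversed path to the front, where it matches the first edge of the
   original one. *)
rewrite rev_cons -cats1 pairmap_cat (perm_big _ (permEl (perm_catC _ _))) /=.
rewrite !big_cons IHp.
have -> : last (last c p) (rev (belast c p)) = c.
  by case: p {IHp} => //= d p; rewrite rev_cons last_rcons.
by rewrite ups_sym.
Qed.

Lemma is_path_rev X a b p :
  is_path X a b p -> is_path X b a (rev (belast a p)).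
Proof.
case/and3P => pth /eqP <- uniq_p; apply/and3P; split.
- by rewrite rev_path (@eq_path _ _ (edge X)) // => x y; rewrite /edge ups_sym.
- by case: p {pth uniq_p} => //= c p; rewrite rev_cons last_rcons.
- by rewrite -rev_rcons -lastI rev_uniq.
Qed.

Lemma conn_strength_le_sym X a b : conn_strength X a b <= conn_strength X b a.
Proof.
apply: bigmax_le => [|p pth].
  exact: bigmax_ge_id.
have szq : (size (rev (belast a p)) <= #|V|)%N.
  by rewrite size_rev size_belast size_bseq.
apply: (bigmax_sup (Bseq szq)) => /=; first exact: is_path_rev.
by have /and3P[_ /eqP<- _] := pth; rewrite path_strength_rev.
Qed.

Lemma conn_strength_sym X a b : conn_strength X a b = conn_strength X b a.
Proof. by apply/le_anti; rewrite !conn_strength_le_sym. Qed.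

(** Needed because [delete_edge X a b] and [delete_edge X b a] are distinct records whose weights
    agree only pointwise. *)
Lemma eq_conn_strength X Y a b :
  ups X =2 ups Y -> conn_strength X a b = conn_strength Y a b.
Proof.
move=> eqXY; apply: eq_big => [p|p _].
  by rewrite /is_path (@eq_path _ _ (edge Y)) // => x y; rewrite /edge eqXY.
rewrite /path_strength; congr bigop.
by elim: (bseqval p) a => //= c q IHq a; rewrite eqXY IHq.
Qed.

Lemma strong_edge_sym X : symmetric (strong_edge X).
Proof.
move=> a b; rewrite /strong_edge /edge (ups_sym X b a) conn_strength_sym.
rewrite (@eq_conn_strength _ (delete_edge X b a)) // => x y /=.
by rewrite /deleted_ups orbC.
Qed.

Lemma strong_edge_irr X : irreflexive (strong_edge X).
Proof. by move=> a; rewrite /strong_edge /edge ups_loopless ltxx. Qed.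

(** Closed neighborhoods absorb the case [b \in D], so domination becomes a covering condition, the
    form that fits private neighborhoods. *)
Lemma is_sdsP X D :
  reflect (forall b, exists2 a, a \in D & b \in strong_nbhd X a) (is_sds X D).
Proof.
apply: (iffP forallP) => [sdsD b|sdsD b].
  have [bD|bD] := boolP (b \in D); first by exists b; rewrite ?inE ?eqxx.
  have /implyP/(_ bD)/existsP[a /andP[aD ab]] := sdsD b.
  by exists a; rewrite ?inE ?ab ?orbT.
apply/implyP=> bD; have [a aD] := sdsD b; rewrite inE => /predU1P[ba|ab].
  by rewrite ba aD in bD.
by apply/existsP; exists a; rewrite aD.
Qed.

Lemma private_nbhdP X a S b :
  reflect (b \in strong_nbhd X a /\
           forall c, c \in S -> b \in strong_nbhd X c -> c = a)
          (b \in private_nbhd X a S).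
Proof.
rewrite in_setD andbC; apply: (iffP andP) => -[ab priv]; split=> //.
  move=> c cS cb; apply/eqP/negPn/negP=> ca; case/negP: priv.
  by apply/bigcupP; exists c; rewrite // in_setD1 ca.
apply/negP=> /bigcupP[c]; rewrite in_setD1 => /andP[/eqP ca cS] cb.
by apply: ca; exact: priv.
Qed.

(** If [a] had no private neighbor, the rest of [D] would cover all that [a] covers, and [a] could
    be removed. *)
Lemma msds_irredundant X D : is_msds X D -> irredundant X D.
Proof.
case/andP=> /is_sdsP sdsD /forallP minD; apply/forallP=> a; apply/implyP=> aD.
apply: contraL (implyP (minD a) aD) => /eqP priv0; rewrite negbK.
apply/is_sdsP=> b; have [c cD cb] := sdsD b.
have [ca|ca] := eqVneq c a; last by exists c; rewrite // in_setD1 ca.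
have /negP := in_set0 b; rewrite -priv0 => bNpriv.
have [/existsP[d /andP[dD db]]|noD] :=
  boolP [exists d, (d \in D :\ a) && (b \in strong_nbhd X d)].
  by exists d.
case: bNpriv; apply/private_nbhdP; split=> [|d dD db]; first by rewrite -ca.
apply/eqP; apply: contraNT noD => da.
by apply/existsP; exists d; rewrite in_setD1 da dD.
Qed.

(** Since [D] already covers every vertex, a new vertex [a] has nothing private. *)
Lemma msds_maximal_irredundant X D : is_msds X D -> maximal_irredundant X D.
Proof.
move=> msdsD; rewrite /maximal_irredundant msds_irredundant //=.
have /andP[/is_sdsP sdsD _] := msdsD.
apply/forallP=> a; apply/implyP=> aD; apply/forallPn; exists a.
rewrite setU11 /= negbK; apply/set0Pn=> -[b /private_nbhdP[_ priv]].
have [c cD cb] := sdsD b.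
by rewrite -(priv c _ cb) ?cD // in_setU1 cD orbT in aD.
Qed.

Lemma sds_sub_msds X D : is_sds X D -> exists2 S, is_msds X S & S \subset D.
Proof.
case/minset_exists=> S /minsetP[sdsS minS] subSD; exists S => //.
rewrite /is_msds sdsS; apply/forallP=> a; apply/implyP=> aS; apply/negP=> sdsSa.
by have := aS; rewrite -(minS _ sdsSa (subD1set S a)) setD11.
Qed.

Definition strong_independent X S : bool :=
  [forall a in S, forall b in S, ~~ strong_edge X a b].

Lemma strong_independentP X S :
  reflect {in S &, forall a b, ~~ strong_edge X a b} (strong_independent X S).
Proof.
apply: (iffP forall_inP) => [ind a b aS bS|ind a aS].
  exact: (forall_inP (ind a aS)).
by apply/forall_inP=> b bS; exact: ind.
Qed.

(** An undominated vertex could be added to [S], against maximality. *)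
Lemma maximal_strong_independent_msds X S :
  maxset (strong_independent X) S -> is_msds X S.
Proof.
case/maxsetP=> /strong_independentP indS maxS; apply/andP; split.
  apply/forallP=> b; apply/implyP=> bS; apply: contraNT bS => /existsPn nob.
  have sb a : a \in S -> ~~ strong_edge X a b.
    by move=> aS; have := nob a; rewrite aS.
  rewrite -(maxS (b |: S)) ?setU11 ?subsetU1 //; apply/strong_independentP.
  move=> x y /setU1P[->|xS] /setU1P[->|yS].
  - by rewrite strong_edge_irr.
  - by rewrite strong_edge_sym sb.
  - exact: sb.
  - exact: indS.
(* Once removed, [a] would itself need a strong neighbor in [S], against independence. *)
apply/forall_inP=> a aS; apply/negP=> /is_sdsP/(_ a)[c].
rewrite in_setD1 inE eq_sym => /andP[/negPf-> cS] /=.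
by apply/negP; exact: indS.
Qed.

Lemma mem_msds X u : exists2 D, is_msds X D & u \in D.
Proof.
have ind1 : strong_independent X [set u].
  by apply/strong_independentP=> a b /set1P-> /set1P->; rewrite strong_edge_irr.
have [D maxD] := maxset_exists ind1; rewrite sub1set => uD.
by exists D => //; exact: maximal_strong_independent_msds.
Qed.

Lemma vertex_weight_ge0 X a : 0 <= vertex_weight X a.
Proof.
by apply: le_bigmin => [|b _]; [exact: ler01 | case/andP: (ups_itv X a b)].
Qed.

Lemma weight_subset X S T : S \subset T -> weight X S <= weight X T.
Proof.
move=> subST; rewrite /weight [leRHS](big_setID S) /= (setIidPr subST).
by rewrite lerDl; apply: sumr_ge0 => a _; exact: vertex_weight_ge0.
Qed.

Lemma min_weight_le X P S : P S -> (min_weight X P <= (weight X S)%:E)%E.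
Proof. by move=> PS; exact: bigmin_le_cond. Qed.

Lemma max_weight_ge X P S : P S -> ((weight X S)%:E <= max_weight X P)%E.
Proof. by move=> PS; exact: le_bigmax_cond. Qed.

(** An empty [Q] is harmless, its minimum being [+oo]. *)
Lemma min_weight_dominated X P Q :
  (forall S, Q S -> exists2 T, P T & T \subset S) ->
  (min_weight X P <= min_weight X Q)%E.
Proof.
move=> domPQ; apply: le_bigmin => [|S /domPQ[T PT subTS]].
  exact: leey.
by apply: le_trans (min_weight_le X PT) _; rewrite lee_fin weight_subset.
Qed.

Lemma max_weight_subpred X P Q :
  subpred P Q -> (max_weight X P <= max_weight X Q)%E.
Proof.
move=> subPQ; apply: bigmax_le => [|S /subPQ QS]; first exact: leNye.
exact: max_weight_ge.
Qed.

End StrongDomination.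

Theorem proposition3p24 (R : realType) (V : finType) (X : fuzzy_graph R V)
    (Xstrong : forall a : V, exists b : V, strong_edge X a b) (u : V) :
  [/\ (ir_s X <= gamma_s X)%E,
      (gamma_s X <= sd_degree X u)%E,
      (sd_degree X u <= Gamma_s X)%E
    & (Gamma_s X <= IR_s X)%E].
Proof.
split.
- apply: min_weight_dominated => D /sds_sub_msds[S msdsS subSD].
  by exists S => //; exact: msds_maximal_irredundant.
- by apply: min_weight_dominated => D /andP[/andP[sdsD _] _]; exists D.
(* The weight of a single such [D] separates the minimum from the maximum. *)
- have [D msdsD uD] := mem_msds X u.
  apply: (@le_trans _ _ (weight X D)%:E%E).
    by apply: min_weight_le; rewrite msdsD.
  exact: max_weight_ge.
- by apply: max_weight_subpred => D; exact: msds_irredundant.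
Qed.
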